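(* Suppose that $x_a<x_b$ $\mu$-a.e. and that there is no Slater point, i.e. there is no $\hat x\in L^p(\mu)$ with $x_a<\hat x<x_b$ $\mu$-a.e. on $\Omega$, $\langle g_i,\hat x\rangle\le a_i$ for all $i=1,\dots,n$ and $\langle h_j,\hat x\rangle=b_j$ for all $j=1,\dots,m$. Further assume that $p>1$ (i.e. $p'<\infty$) and that the measure $\mu$ is nonatomic. Then, for every feasible point $\bar x\in K\cap P$, the set $\mathcal N_K(\bar x)+\mathcal N_P(\bar x)$ is not closed in $L^{p'}(\mu)$.
   Context: Let $(\Omega,\Sigma,\mu)$ be a $\sigma$-finite measure space, $p\in[1,\infty]$ and $p'\in[1,\infty]$ the conjugate exponent, $1/p+1/p'=1$ (with $1/\infty=0$). All function spaces are real, and $\langle y,x\rangle=\int_\Omega yx\,d\mu$ for $y\in L^{p'}(\mu)$, $x\in L^p(\mu)$. For $p<\infty$ one identifies $L^p(\mu)^*=L^{p'}(\mu)$. Let $x_a,x_b:\Omega\to[-\infty,\infty]$ be measurable, let $n,m$ be nonnegative integers, and let $g_1,\dots,g_n,h_1,\dots,h_m\in L^{p'}(\mu)$, $a_i,b_j\in\mathbb R$. Put $$K=\{x\in L^p(\mu): x_a\le x\le x_b\ \mu\text{-a.e.}\},\qquad P=\{x\in L^p(\mu): \langle g_i,x\rangle\le a_i\ (1\le i\le n),\ \langle h_j,x\rangle=b_j\ (1\le j\le m)\}.$$ For a closed set $C\subset L^p(\mu)$ and $x\in C$, the (Bouligand) tangent cone is $\mathcal T_C(x)=\{d\in L^p(\mu):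 \exists (x_k)\subset C,\ (t_k)\subset(0,\infty),\ x_k\to x,\ t_k\searrow0,\ (x_k-x)/t_k\to d\}$ (norm convergence in $L^p(\mu)$), and the normal cone is $\mathcal N_C(x)=\{y\in L^{p'}(\mu): \langle y,d\rangle\le0\ \forall d\in\mathcal T_C(x)\}$. In particular, for $p=\infty$ the normal cone is by definition a subset of the predual $L^1(\mu)$. *)

(* Defs.v *)
From HB Require Import structures.
From mathcomp Require Import all_boot all_order all_algebra.
From mathcomp Require Import all_classical all_reals all_analysis.
From mathcomp Require Import measurable_realfun.

Set Implicit Arguments.
Unset Strict Implicit.
Unset Printing Implicit Defensive.

Import Order.TTheory GRing.Theory Num.Theory.
Import numFieldNormedType.Exports.

Local Open Scope classical_set_scope.
Local Open Scope ring_scope.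

(* An element of L^p(mu) is represented by a function of [LfunType mu p1],
   where [p1 : 1 <= p], without passing to the quotient by a.e. equality.
   Every notion below is invariant under modification of functions on null
   sets, and a set of functions that is stable under a.e. equality is closed
   for the Lp-seminorm iff its image in the quotient is closed for the norm.

   The library provides no topology on [LfunType]; we equip it with the
   pseudometric induced by the Lp-seminorm. *)
Section Lp_topology.
Context d (T : measurableType d) (R : realType).
Variables (mu : {measure set T -> \bar R}) (p : \bar R) (p1 : (1 <= p)%E).
Implicit Types (f g h : LfunType mu p1) (e : R).

Definition Lp_ball f e g : Prop :=
  ('N[mu]_p [EFin \o ((f - g)%R : LfunType mu p1)] < e%:E)%E.

Let Lp_ball_center f e : 0 < e -> Lp_ball f e f.
Proof.
move=> e0; rewrite /Lp_ball subrr.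
rewrite (_ : EFin \o _ = cst 0%E); last exact/funext.
by rewrite Lnorm0 ?lte_fin// gt_eqF// (lt_le_trans lte01 p1).
Qed.

Let Lp_ball_sym f g e : Lp_ball f e g -> Lp_ball g e f.
Proof.
rewrite /Lp_ball -(opprB f g).
have -> : ('N[mu]_p [EFin \o ((- (f - g))%R : LfunType mu p1)] =
          'N[mu]_p [\- (EFin \o ((f - g)%R : LfunType mu p1))])%E.
  exact: eq_Lnorm.
by rewrite oppe_Lnorm.
Qed.

Let Lp_ball_triangle f g h e1 e2 :
  Lp_ball f e1 g -> Lp_ball g e2 h -> Lp_ball f (e1 + e2) h.
Proof.
rewrite /Lp_ball => fg gh.
have -> : f - h = (f - g) + (g - h) by rewrite addrA subrK.
rewrite EFinD; apply: le_lt_trans (lteD fg gh).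
exact: eminkowski.
Qed.

HB.instance Definition _ := hasNbhs.Build (LfunType mu p1)
  (nbhs_ (entourage_ Lp_ball)).

HB.instance Definition _ := Nbhs_isPseudoMetric.Build R (LfunType mu p1)
  erefl Lp_ball_center Lp_ball_sym Lp_ball_triangle erefl.

End Lp_topology.

Section cones.
Context d (T : measurableType d) (R : realType).
Variables (mu : {measure set T -> \bar R}).
Variables (p q : \bar R) (p1 : (1 <= p)%E) (q1 : (1 <= q)%E).

(* The product is integrable as soon as p and q are conjugate exponents. *)
Definition pairing (y : LfunType mu q1) (x : LfunType mu p1) : R :=
  \int[mu]_w (y w * x w).

Definition tangent_cone (C : set (LfunType mu p1)) (x : LfunType mu p1) :
    set (LfunType mu p1) :=
  [set v | exists (u : nat -> LfunType mu p1) (t : nat -> R),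
    [/\ forall k, C (u k), forall k, 0 < t k, u @ \oo --> x,
        nonincreasing_seq t /\ t @ \oo --> 0 &
        (t k)^-1 *: (u k - x) @[k --> \oo] --> v]].

(* The normal cone lives in L^q, hence in the predual L^1 when p = +oo. *)
Definition normal_cone (C : set (LfunType mu p1)) (x : LfunType mu p1) :
    set (LfunType mu q1) :=
  [set y | forall v, tangent_cone C x v -> pairing y v <= 0].

Definition box (xa xb : T -> \bar R) : set (LfunType mu p1) :=
  [set x | {ae mu, forall w, (xa w <= (x w)%:E <= xb w)%E}].

Definition polyhedron (n m : nat)
    (g : 'I_n -> LfunType mu q1) (a : 'I_n -> R)
    (h : 'I_m -> LfunType mu q1) (b : 'I_m -> R) : set (LfunType mu p1) :=
  [set x | (forall i, pairing (g i) x <= a i) /\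
           (forall j, pairing (h j) x = b j)].

Definition slater_point (xa xb : T -> \bar R) (n m : nat)
    (g : 'I_n -> LfunType mu q1) (a : 'I_n -> R)
    (h : 'I_m -> LfunType mu q1) (b : 'I_m -> R) (x : LfunType mu p1) : Prop :=
  [/\ {ae mu, forall w, (xa w < (x w)%:E < xb w)%E},
      forall i, pairing (g i) x <= a i &
      forall j, pairing (h j) x = b j].

End cones.

Arguments normal_cone {d T R mu p q p1} q1 C x.
Arguments box {d T R mu p} p1 xa xb.
Arguments polyhedron {d T R mu p q} p1 {q1 n m} g a h b.

Definition nonatomic d (T : measurableType d) (R : realType)
    (mu : {measure set T -> \bar R}) : Prop :=
  forall A, measurable A -> (0 < mu A)%E ->
    exists B, [/\ measurable B, B `<=` A & (0 < mu B < mu A)%E].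

(* Main.v *)
Require Import Defs.
From mathcomp Require Import all_boot all_order all_algebra.
From mathcomp Require Import all_classical all_reals all_analysis.
From mathcomp Require Import measurable_realfun ess_sup_inf.
From mathcomp Require Import lra ring.
Import Order.TTheory GRing.Theory Num.Theory.
Import numFieldNormedType.Exports.

Set Implicit Arguments.
Unset Strict Implicit.
Unset Printing Implicit Defensive.

Local Open Scope classical_set_scope.
Local Open Scope ring_scope.

(** Let [f] be the family made of the [g i] and the [h j], and call a point
    strict if it lies strictly between [xa] and [xb] almost everywhere.

    Multiplier. The cone generated by the differences [c - u], with [c] strict
    and [u] in the polyhedron P, contains no vector that all [f i] annihilate:
    otherwise [c] would satisfy the constraints of P and be a Slater point.  A
    convex cone that avoids the common kernel of finitely many functionals is
    nonnegative for a combination of them that is not the zero functional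
    ([cone_separation]).  This gives [y] in the span of [f], nonzero on a set F
    of positive measure, with [- y] in the normal cone of K = [box p1 xa xb] and
    [y] in that of P at the feasible point [x] ([separating_multiplier]).

    Pointwise signs.  A box is stable under replacing [x] by another of its
    points on a measurable set, so a normal [u] of the box satisfies
    [u * (c - x) <= 0] almost everywhere for every [c] in K
    ([box_localization]).  Since the box has nonempty interior at almost every
    point ([box_interior]), [u] has the sign opposite to [y], or vanishes, on F.
    Conversely a function supported in F whose sign is opposite to [y] is normal
    to K.

    The closure is large.  Given [z] in L^q supported in F, of the sign of [y],
    let [u j] be [z] where [`|z| <= j * `|y|] and [0] elsewhere.  Then
    [u j - j *: y] is normal to K and [j *: y] is normal to P, so [u j] belongs
    to the sum of the normal cones, and [u j] tends to [z] because q is finite.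

    The sum is small.  A normal of P vanishes on the common kernel of the
    [f i], hence is one of their combinations ([normal_cone_span]).  If
    [z = u + v] with [u] normal to K and [v] normal to P, then the sign of [u]
    yields [`|z| <= `|v|] on F, hence [`|z| <= C * G] on F for a constant [C]
    and the fixed L^q function [G = `|y| + \sum_i `|f i|].  As the measure is
    nonatomic, some [z] violates this bound for every [C]
    ([exists_unbounded_multiple]); it lies in the closure of the sum but not in
    the sum. *)

(** * Finitely many linear functionals *)

Section finitely_many_functionals.
Context (R : realType) (X : lmodType R).
Implicit Types (E : set X) (v : X -> R) (c : R) (x y : X).

Definition ord_cons r (s : R) (l : 'I_r -> R) (i : 'I_r.+1) : R :=
  if unlift ord0 i is Some j then l j else s.

Lemma sum_ord_cons r s (l : 'I_r -> R) (f : 'I_r.+1 -> R) :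
  \sum_i ord_cons s l i * f i = s * f ord0 + \sum_i l i * f (lift ord0 i).
Proof.
rewrite big_ord_recl /ord_cons unlift_none; congr (_ + _).
by apply: eq_bigr => i _; rewrite liftK.
Qed.

Lemma scalar_fun_sum r (f : 'I_r -> X -> R) (l : 'I_r -> R) :
  (forall i, scalar (f i)) -> scalar (fun x => \sum_i l i * f i x).
Proof.
move=> lf c x y; rewrite mulr_sumr -big_split; apply: eq_bigr => i _ /=.
by rewrite lf; ring.
Qed.

Lemma scalar_fun0 v : scalar v -> v 0 = 0.
Proof. by move=> lv; have := lv (-1) 0 0; rewrite scaler0 addr0; lra. Qed.

Lemma scalar_fun_scale v c x : scalar v -> v (c *: x) = c * v x.
Proof. by move=> lv; rewrite -[c *: x]addr0 lv scalar_fun0// addr0. Qed.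

Lemma scalar_fun_add v x y : scalar v -> v (x + y) = v x + v y.
Proof. by move=> lv; rewrite -[x in LHS]scale1r lv mul1r. Qed.

Lemma scalar_fun_subZ v c f : scalar v -> scalar f -> scalar (fun x => v x - c * f x).
Proof. by move=> lv lf k x y; rewrite lv lf; ring. Qed.

(** Induction on the number of functionals: either the first one already
    vanishes on the common kernel of the others and can be dropped, or a vector
    [x0] of that kernel on which it is nonzero allows its contribution to be
    subtracted from [v]. *)
Lemma span_of_common_kernel r (f : 'I_r -> X -> R) v :
    (forall i, scalar (f i)) -> scalar v ->
    (forall x, (forall i, f i x = 0) -> v x = 0) ->
  exists l : 'I_r -> R, forall x, v x = \sum_i l i * f i x.
Proof.
elim: r f v => [|r IH] f v lf lv ker.
  by exists (fun=> 0) => x; rewrite big_ord0 ker// => -[].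
have lf' i : scalar (f (lift ord0 i)) by exact: lf.
have [dep|/existsNP[x0 /not_implyP[x00 /eqP fx0]]] :=
    pselect (forall x, (forall i, f (lift ord0 i) x = 0) -> f ord0 x = 0).
  have [|l vl] := IH _ v lf' lv.
    by move=> x fx; apply: ker => i; case: (unliftP ord0 i) => [j|] ->; auto.
  by exists (ord_cons 0 l) => x; rewrite sum_ord_cons mul0r add0r.
have [|l vl] := IH _ _ lf' (scalar_fun_subZ (v x0 / f ord0 x0) lv (lf ord0)).
  move=> x fx; have lfx i := lf i (- (f ord0 x / f ord0 x0)) x0 x.
  have := ker (- (f ord0 x / f ord0 x0) *: x0 + x).
  rewrite lv => kerx; rewrite -[RHS]kerx.
    by field.
  move=> i; rewrite lfx; case: (unliftP ord0 i) => [j|] ->.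
    by rewrite x00 fx mulr0 addr0.
  by field.
exists (ord_cons (v x0 / f ord0 x0) l) => x.
by rewrite sum_ord_cons -vl addrC subrK.
Qed.

(** A finite dimensional separation theorem that is proper by construction: the
    conclusion excludes a combination that vanishes identically, even if the
    functionals are linearly dependent.  The induction is on their number.  If
    the first functional takes both signs on the cone, the others separate its
    zero section, and its own coefficient is found as in the one-step
    extension of the Hahn-Banach theorem; otherwise the first functional or its
    opposite separates alone, unless it depends on the others. *)
Lemma cone_separation r (f : 'I_r -> X -> R) E :
    (forall i, scalar (f i)) -> E !=set0 ->
    (forall x y, E x -> E y -> E (x + y)) ->
    (forall t x, 0 < t -> E x -> E (t *: x)) ->
    (forall x, E x -> ~ forall i, f i x = 0) ->
  exists l : 'I_r -> R, (forall x, E x -> 0 <= \sum_i l i * f i x) /\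
    exists x, \sum_i l i * f i x != 0.
Proof.
elim: r f E => [|r IH] f E lf [e0 Ee0] ED EZ Ef.
  by exfalso; apply: (Ef e0) => // -[].
have lf' i : scalar (f (lift ord0 i)) by exact: lf.
have [dep|/existsNP[x0 /not_implyP[x00 /eqP fx0]]] :=
    pselect (forall x, (forall i, f (lift ord0 i) x = 0) -> f ord0 x = 0).
  have [| |l [l0 [x1 lx1]]] := IH (fun i => f (lift ord0 i)) E lf' _ ED EZ.
  - by exists e0.
  - move=> x Ex fx; apply: (Ef x) => // i.
    by case: (unliftP ord0 i) => [j|] ->; auto.
  - exists (ord_cons 0 l); split.
      by move=> x Ex; rewrite sum_ord_cons mul0r add0r l0.
    by exists x1; rewrite sum_ord_cons mul0r add0r.
have nz s (l : 'I_r -> R) : s != 0 ->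
    exists x, \sum_i ord_cons s l i * f i x != 0.
  move=> s0; exists x0; rewrite sum_ord_cons big1 ?addr0 ?mulf_neq0//.
  by move=> i _; rewrite x00 mulr0.
have [Epos|/existsNP[em /not_implyP[Eem /negP]]] :=
    pselect (forall x, E x -> 0 <= f ord0 x).
  exists (ord_cons 1 (fun=> 0)); split; last by apply: nz; rewrite oner_eq0.
  move=> x Ex; rewrite sum_ord_cons mul1r big1 ?addr0 ?Epos// => i _.
  by rewrite mul0r.
rewrite -ltNge => fem.
have [Eneg|/existsNP[ep /not_implyP[Eep /negP]]] :=
    pselect (forall x, E x -> f ord0 x <= 0).
  exists (ord_cons (-1) (fun=> 0)); split.
    move=> x Ex; rewrite sum_ord_cons mulN1r big1 ?addr0 ?oppr_ge0 ?Eneg// => i _.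
    by rewrite mul0r.
  by apply: nz; rewrite oppr_eq0 oner_eq0.
rewrite -ltNge => fep.
have mix x y : E x -> E y -> f ord0 x < 0 -> 0 < f ord0 y ->
    E (f ord0 y *: x + (- f ord0 x) *: y) /\
    f ord0 (f ord0 y *: x + (- f ord0 x) *: y) = 0.
  move=> Ex Ey fx fy; split; first by apply: ED; apply: EZ => //; rewrite oppr_gt0.
  by rewrite lf scalar_fun_scale//; ring.
have [| | | |l [l0 [x1 lx1]]] := IH (fun i => f (lift ord0 i))
    (E `&` [set x | f ord0 x = 0]) lf'.
- by exists (f ord0 ep *: em + (- f ord0 em) *: ep); exact: mix.
- move=> x y [Ex fx] [Ey fy]; split; first exact: ED.
  by rewrite /= scalar_fun_add// fx fy addr0.
- move=> t x t0 [Ex fx]; split; first exact: EZ.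
  by rewrite /= scalar_fun_scale// fx mulr0.
- move=> x [Ex fx] fx'; apply: (Ef x) => // i.
  by case: (unliftP ord0 i) => [j|] -> //.
pose L x := \sum_i l i * f (lift ord0 i) x.
have lL : scalar L by exact: scalar_fun_sum.
(* The admissible coefficients of the first functional lie between the
   elements of [S], given by the side where it is positive, and the bounds
   [L x / - f ord0 x], given by the side where it is negative. *)
pose S := [set - (L y / f ord0 y) | y in E `&` [set y | 0 < f ord0 y]].
have Sub x : E x -> f ord0 x < 0 -> ubound S (L x / - f ord0 x).
  move=> Ex fx _ [y [Ey fy] <-]; rewrite /= in fy.
  have [Ez fz] := mix _ _ Ex Ey fx fy.
  have := l0 _ (conj Ez fz); rewrite -/(L _) lL scalar_fun_scale// => Lz.
  have fx' : 0 < - f ord0 x by rewrite oppr_gt0.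
  rewrite -mulNr ler_pdivrMr// mulrAC ler_pdivlMr//; lra.
have S0 : S !=set0 by exists (- (L ep / f ord0 ep)); exists ep.
have hS : has_ubound S by exists (L em / - f ord0 em); exact: Sub.
exists (ord_cons (sup S) l); split.
  move=> x Ex; rewrite sum_ord_cons -/(L x).
  have [fx|fx|fx] := ltgtP (f ord0 x) 0.
  - have : sup S <= L x / - f ord0 x by apply: ge_sup => //; exact: Sub.
    by rewrite ler_pdivlMr ?oppr_gt0//; lra.
  - have : - (L x / f ord0 x) <= sup S by apply: ub_le_sup => //; exists x.
    by rewrite -mulNr ler_pdivrMr//; lra.
  - by rewrite fx mulr0 add0r l0.
have [->|s0] := eqVneq (sup S) 0; last exact: nz.
by exists x1; rewrite sum_ord_cons mul0r add0r.
Qed.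

End finitely_many_functionals.

(** Used to pass from strict points of a box to all its points along a
    segment. *)
Lemma affine_ge0 (R : realType) (a b : R) :
  (forall s, 0 < s -> s <= 1 -> 0 <= a + s * b) -> 0 <= a.
Proof.
move=> ab; rewrite leNgt; apply/negP => a0.
have [b0|b0] := leP b (- a / 2); first by have := ab 1 ltr01 (lexx _); lra.
have b_gt0 : 0 < b by lra.
have s0 : 0 < - a / 2 / b by rewrite divr_gt0//; lra.
have := ab _ s0; rewrite divfK ?gt_eqF// ler_pdivrMr// mul1r => /(_ (ltW b0)).
lra.
Qed.

(** * Functions in Lp *)

Section Lp_facts.
Context d (T : measurableType d) (R : realType).
Variables (mu : {measure set T -> \bar R}).

Lemma measurable_abse_poweR (r : R) (f : T -> R) : measurable_fun setT f ->
  measurable_fun setT (fun w => `|(EFin \o f) w| `^ r)%E.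
Proof.
move=> mf; apply: (@measurableT_comp _ _ _ _ _ _ (fun x => x `^ r)%E) => //=.
  exact: measurable_poweR.
by apply/measurable_EFinP; exact: measurableT_comp.
Qed.

Lemma le_Lnorm_ae (p : \bar R) (f g : T -> R) : (1 <= p)%E ->
  measurable_fun setT f -> measurable_fun setT g ->
  {ae mu, forall w, `|f w| <= `|g w|} ->
  ('N[mu]_p[EFin \o f] <= 'N[mu]_p[EFin \o g])%E.
Proof.
move=> p1 mf mg fg; rewrite unlock /Lnorm; case: p p1 => [r|_|//].
- rewrite lee_fin => r1; have r0 : 0 <= r by apply: le_trans r1.
  rewrite gt0_ler_poweR ?invr_ge0// ?in_itv/= ?leey ?andbT.
  + by apply: integral_ge0 => w _; rewrite lee_fin powR_ge0.
  + by apply: integral_ge0 => w _; rewrite lee_fin powR_ge0.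
  + apply: ae_ge0_le_integral => //; [exact: measurable_abse_poweR|exact: measurable_abse_poweR|].
    apply: filterS fg => w fgw _ /=.
      by rewrite lee_fin ge0_ler_powR ?nnegrE.
- case: ifPn => // _; apply: le_ess_sup; apply: filterS fg => w fgw /=.
  by rewrite lee_fin.
Qed.

Lemma Lfun_dominated (p : \bar R) (f g : T -> R) : (1 <= p)%E ->
  measurable_fun setT f -> g \in Lfun mu p ->
  {ae mu, forall w, `|f w| <= `|g w|} -> f \in Lfun mu p.
Proof.
move=> p1 mf /andP[/[!inE]/= mg ng] fg; apply/andP; rewrite !inE/=; split => //.
exact: le_lt_trans (le_Lnorm_ae p1 mf mg fg) ng.
Qed.

(** Hoelder's inequality including the pair [(+oo, 1)], where the bound comes
    from the essential supremum. *)
Lemma hoelder_conj (p q : \bar R) (f g : T -> R) :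
  (1 < p)%E -> (1 <= q)%E -> (p^-1 + q^-1 = 1)%E ->
  measurable_fun setT f -> measurable_fun setT g ->
  ('N[mu]_1[EFin \o (f \* g)%R] <= 'N[mu]_q[EFin \o f] * 'N[mu]_p[EFin \o g])%E.
Proof.
move=> p1 q1 pq mf mg.
case: p p1 pq => [r|_|//].
- rewrite lte_fin => r1.
  have r0 : 0 < r by apply: lt_trans r1.
  rewrite inver gt_eqF//; case: q q1 => [s|_|//].
  + rewrite lee_fin => s1.
    have s0 : 0 < s by apply: lt_le_trans s1.
    rewrite inver gt_eqF// -EFinD => -[rs].
    by apply: hoelder => //; rewrite addrC.
  + rewrite invey adde0 => -[/eqP]; rewrite invr_eq1 => /eqP r1'.
    by move: r1; rewrite r1' ltxx.
- rewrite invey add0e => /eqP; rewrite inve_eq1 => /eqP ->.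
  rewrite !Lnorm1 unlock /Lnorm.
  have mF : measurable_fun setT (abse \o (EFin \o f)).
    by apply: measurableT_comp => //; exact/measurable_EFinP.
  case: ifPn => [mu0|]; last first.
    rewrite -leNgt measure_le0 => /eqP mu0.
    rewrite mule0 integral_abs_eq0//.
    by apply/measurable_EFinP; exact: measurable_funM.
  set M := ess_sup mu _.
  have M0 : (0 <= M)%E by apply: ess_sup_gee => //; apply: nearW => w /=.
  have -> : (\int[mu]_x `|(EFin \o f) x| * M = \int[mu]_x (M * `|(EFin \o f) x|))%E.
    by rewrite ge0_integralZl// muleC.
  apply: ae_ge0_le_integral => //.
  + apply: measurableT_comp => //.
    by apply/measurable_EFinP; exact: measurable_funM.
  + by move=> w _; apply: mule_ge0.
  + exact: measurable_funeM.
  have := ess_sup_ge mu (abse \o (EFin \o g)).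
  apply: filterS => w Mw _ /=; rewrite normrM EFinM muleC.
  exact: lee_wpmul2r.
Qed.

(** Dominated convergence for the [r]-th power of the error; this is where the
    finiteness of the exponent matters. *)
Lemma cvg_eventually_eq (r : R) (r1 : (1 <= r%:E)%E)
    (u : nat -> LfunType mu r1) (z : LfunType mu r1) :
    (forall w k, `|z w - u k w| <= `|z w|) ->
    (forall w, \forall k \near \oo, u k w = z w) ->
  u @ \oo --> z.
Proof.
move=> uz uE; apply/cvg_ballP => e e0.
have r0 : 0 < r by apply: (@lt_le_trans _ _ 1).
pose F k w := (`|z w - u k w| `^ r)%:E.
have mF k : measurable_fun setT (F k).
  exact: (measurable_abse_poweR r (measurable_funPT (z - u k))).
have F0 : {ae mu, forall w, setT w -> (F ^~ w @ \oo --> cst 0 w)%E}.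
  apply: nearW => w _; apply: cvg_near_cst; apply: filterS (uE w) => k uk.
  by rewrite /F uk subrr normr0 powR0// gt_eqF.
have FG : {ae mu, forall w k, setT w -> (`|F k w| <= (`|z w| `^ r)%:E)%E}.
  apply: nearW => w k _; rewrite /F gee0_abs ?lee_fin ?powR_ge0//.
  by apply: ge0_ler_powR; rewrite ?nnegrE ?(ltW r0).
have [_ _] := dominated_convergence measurableT mF (measurable_cst 0%E)
  F0 (Lfun_integrable r1 (LfunP z)) FG.
rewrite integral_cst// mul0e => /fine_cvgP[Ffin /cvgrPdist_lt /(_ (e `^ r) (powR_gt0 _ e0))].
move=> H; near=> k; rewrite /ball/= /Lp_ball.
have Fk : (\int[mu]_w F k w < (e `^ r)%:E)%E.
  have Fkfin : (\int[mu]_w F k w)%E \is a fin_num by near: k.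
  rewrite -(fineK Fkfin) lte_fin.
  have : `|0 - fine (\int[mu]_w F k w)%E| < e `^ r by near: k.
  by rewrite sub0r normrN; apply: le_lt_trans; exact: ler_norm.
rewrite ltNge; apply/negP => eN.
have : ((e `^ r)%:E <= 'N[mu]_r%:E[EFin \o (z - u k)%R] `^ r)%E.
  rewrite -poweR_EFin gt0_ler_poweR ?(ltW r0)// ?in_itv/= ?leey ?andbT//.
  - by rewrite lee_fin ltW.
  - exact: Lnorm_ge0.
by rewrite poweR_Lnorm ?gt_eqF// leNgt Fk.
Unshelve. all: by end_near. Qed.

End Lp_facts.

Section Lfun_pointwise.
Context d (T : measurableType d) (R : realType).
Variables (mu : {measure set T -> \bar R}) (p : \bar R) (p1 : (1 <= p)%E).
Implicit Types f g : LfunType mu p1.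

Lemma LfunDE f g w : (f + g) w = f w + g w. Proof. by []. Qed.

Lemma LfunNE f w : (- f) w = - f w. Proof. by []. Qed.

Lemma LfunBE f g w : (f - g) w = f w - g w. Proof. by []. Qed.

Lemma LfunZE c f w : (c *: f) w = c * f w. Proof. by []. Qed.

Lemma Lfun_sumE (r : nat) (F : 'I_r -> LfunType mu p1) w :
  (\sum_i F i) w = \sum_i F i w.
Proof. by elim/big_rec2: _ => //= i a b _ <-. Qed.

Lemma abs_Lfun (g : LfunType mu p1) : (fun w => `|g w|) \in Lfun mu p.
Proof.
apply: (Lfun_dominated p1 _ (LfunP g)); first exact: measurableT_comp.
by apply: nearW => w; rewrite normr_id.
Qed.

Definition Lfun_abs (g : LfunType mu p1) : LfunType mu p1 :=
  Lfun_Sub p1 (abs_Lfun g).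

End Lfun_pointwise.

(** * The duality pairing *)

Section pairing_theory.
Context d (T : measurableType d) (R : realType).
Variables (mu : {measure set T -> \bar R}).
Variables (p q : \bar R) (p1 : (1 <= p)%E) (q1 : (1 <= q)%E).
Hypothesis p_gt1 : (1 < p)%E.
Hypothesis pq : (p^-1 + q^-1 = 1)%E.
Implicit Types (x : LfunType mu p1) (y : LfunType mu q1).

Lemma pairing_integrable y x : mu.-integrable setT (EFin \o (fun w => y w * x w)).
Proof.
apply/integrableP; split.
  by apply/measurable_EFinP; exact: measurable_funM.
have := hoelder_conj mu p_gt1 q1 pq (measurable_funPT y) (measurable_funPT x).
rewrite Lnorm1 => /le_lt_trans; apply.
by rewrite -[X in (X * _)%E]finite_norm_fine -[X in (_ * X)%E]finite_norm_fine -EFinM ltry.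
Qed.

Lemma pairing_scalar y : scalar (pairing y : LfunType mu p1 -> R).
Proof.
move=> c x x'; rewrite /pairing.
rewrite -RintegralZl//; last exact: pairing_integrable.
rewrite -RintegralD//; last exact: pairing_integrable.
- by apply: eq_Rintegral => w _; rewrite LfunDE LfunZE; ring.
- rewrite (_ : _ \o _ = EFin \o (fun w => y w * (c *: x) w)).
    exact: pairing_integrable.
  by apply/funext => w /=; rewrite mulrCA.
Qed.

Lemma pairing_scalarl x : scalar (fun y : LfunType mu q1 => pairing y x).
Proof.
move=> c y y'; rewrite /pairing.
rewrite -RintegralZl//; last exact: pairing_integrable.
rewrite -RintegralD//; last exact: pairing_integrable.
- by apply: eq_Rintegral => w _; rewrite LfunDE LfunZE; ring.
- rewrite (_ : _ \o _ = EFin \o (fun w => (c *: y) w * x w)).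
    exact: pairing_integrable.
  by apply/funext => w /=; rewrite mulrA.
Qed.

Lemma pairingZr y c x : pairing y (c *: x) = c * pairing y x.
Proof. exact: (scalar_fun_scale _ _ (pairing_scalar y)). Qed.

Lemma pairingDr y x x' : pairing y (x + x') = pairing y x + pairing y x'.
Proof. exact: (scalar_fun_add _ _ (pairing_scalar y)). Qed.

Lemma pairingBr y x x' : pairing y (x - x') = pairing y x - pairing y x'.
Proof. by rewrite pairingDr -scaleN1r pairingZr mulN1r. Qed.

Lemma pairingZl c y x : pairing (c *: y) x = c * pairing y x.
Proof. exact: (scalar_fun_scale _ _ (pairing_scalarl x)). Qed.

Lemma pairingBl y y' x : pairing (y - y') x = pairing y x - pairing y' x.
Proof.
rewrite (scalar_fun_add _ _ (pairing_scalarl x)) -scaleN1r.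
by rewrite (scalar_fun_scale _ _ (pairing_scalarl x)) mulN1r.
Qed.

Lemma pairing_suml r (l : 'I_r -> R) (f : 'I_r -> LfunType mu q1) x :
  pairing (\sum_i l i *: f i) x = \sum_i l i * pairing (f i) x.
Proof.
elim/big_rec2: _ => [|i y s _ <-]; last exact: pairing_scalarl.
exact: (scalar_fun0 (pairing_scalarl x)).
Qed.

Lemma le_pairing y x :
  (`|pairing y x|%:E <= 'N[mu]_q[EFin \o y] * 'N[mu]_p[EFin \o x])%E.
Proof.
apply: le_trans (hoelder_conj mu p_gt1 q1 pq (measurable_funPT y) (measurable_funPT x)).
have iyx := pairing_integrable y x.
rewrite Lnorm1 -abse_EFin /pairing /Rintegral fineK; last exact: integrable_fin_num.
by apply: le_abse_integral => //; exact: (measurable_int mu).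
Qed.

(** Continuity of the pairing in its second argument, in the form that passes
    inequalities to limits in the definition of the tangent cone. *)
Lemma cvg_pairing_le0 y (u : nat -> LfunType mu p1) x :
  u @ \oo --> x -> (forall k, pairing y (u k) <= 0) -> pairing y x <= 0.
Proof.
move=> ux u0; rewrite leNgt; apply/negP => yx.
pose N : R := fine 'N[mu]_q[EFin \o y].
have N0 : 0 <= N by apply: fine_ge0; exact: Lnorm_ge0.
have e0 : 0 < pairing y x / (N + 1) by rewrite divr_gt0// ltr_wpDl.
have [k _ /(_ k (leqnn k))] := cvg_ball ux e0.
rewrite /ball/= /Lp_ball => xuk.
have := le_pairing y (x - u k).
rewrite -finite_norm_fine -/N => /le_trans.
move=> /(_ (N%:E * (pairing y x / (N + 1))%:E)%E).
move=> /(_ (lee_wpmul2l _ (ltW xuk))); rewrite !lee_fin => /(_ N0).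
rewrite pairingBr.
have yuk := u0 k.
rewrite ger0_norm; last by lra.
move=> h; have : pairing y x <= N * (pairing y x / (N + 1)) by lra.
rewrite mulrA ler_pdivlMr ?ltr_wpDl// mulrDr mulr1 mulrC.
by lra.
Qed.

Lemma pairing_le0_ae y x : (forall w, 0 <= y w * x w) -> pairing y x <= 0 ->
  {ae mu, forall w, y w * x w = 0}.
Proof.
move=> yx0 yx; have iyx := pairing_integrable y x.
have : (\int[mu]_w `|(EFin \o (fun w => y w * x w)%R) w| = 0)%E.
  apply/eqP; rewrite eq_le integral_ge0// andbT.
  under eq_integral => w _ do rewrite /= ger0_norm//.
  by rewrite -lee_fin /pairing /Rintegral fineK// in yx; exact: integrable_fin_num.
move=> /(ae_eq_integral_abs mu measurableT (measurable_int mu iyx)).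
by apply: filterS => w /(_ I) /= [].
Qed.

Lemma ae_pairing_le0 y x : {ae mu, forall w, y w * x w <= 0} -> pairing y x <= 0.
Proof.
move=> yx; have iyx := pairing_integrable y x.
pose f w := (y w * x w)%:E.
have mf : measurable_fun setT f := measurable_int mu iyx.
rewrite -lee_fin /pairing /Rintegral fineK; last exact: integrable_fin_num.
rewrite integralE (ae_eq_integral (cst 0%E))//.
- by rewrite integral0 sub0e oppe_le0 integral_ge0.
- exact: measurable_funepos.
- by apply: filterS yx => w yxw _; rewrite /= funeposE; apply/max_idPr; rewrite lee_fin.
Qed.

End pairing_theory.

(** * Normal cones of star-shaped sets and of boxes *)

Section normal_cones.
Context d (T : measurableType d) (R : realType).
Variables (mu : {measure set T -> \bar R}).
Variables (p q : \bar R) (p1 : (1 <= p)%E) (q1 : (1 <= q)%E).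
Hypothesis p_gt1 : (1 < p)%E.
Hypothesis pq : (p^-1 + q^-1 = 1)%E.
Implicit Types (x : LfunType mu p1) (y : LfunType mu q1).

(** From a star-shaped set every difference [c - x] is a tangent direction, so
    the limits in the definition of the tangent cone can be dispensed with. *)
Lemma normal_cone_starP (C : set (LfunType mu p1)) x y :
    (forall c (t : R), C c -> 0 < t -> t <= 1 -> C (x + t *: (c - x))) ->
  normal_cone q1 C x y <-> forall c, C c -> pairing y (c - x) <= 0.
Proof.
move=> starC; split => [Ny c Cc|yC v [u [t [Cu t0 _ _ uv]]]]; last first.
  apply: (cvg_pairing_le0 p_gt1 pq uv) => k.
  rewrite pairingZr//.
  by rewrite pmulr_rle0 ?invr_gt0//; exact: yC.
apply: Ny; pose t k : R := k.+1%:R^-1.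
have t0 k : 0 < t k by rewrite invr_gt0.
have t1 k : t k <= 1 by rewrite invf_le1// ler1n.
exists (fun k => x + t k *: (c - x)), t; split => //.
- by move=> k; exact: starC.
- apply/cvg_ballP => e e0.
  pose N : R := fine 'N[mu]_p[EFin \o (c - x)].
  have N0 : 0 <= N by apply: fine_ge0; exact: Lnorm_ge0.
  have eN : 0 < e / (N + 1) by rewrite divr_gt0// ltr_wpDl.
  have [K _ HK] := near_infty_natSinv_lt (PosNum eN).
  exists K => // k /HK /= tk; rewrite /ball/= /Lp_ball opprD addrA subrr add0r.
  rewrite -scaleNr; have := LnormZ (c - x) (- t k).
  rewrite -finite_norm_fine -/N normrN gtr0_norm// -EFinM => H.
  apply: (@le_lt_trans _ _ (t k * N)%:E); first by rewrite -H.
  rewrite lte_fin; apply: (@le_lt_trans _ _ (t k * (N + 1))).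
    by rewrite ler_pM2l// lerDl.
  by rewrite -ltr_pdivlMr// ltr_wpDl.
- split; last exact: cvg_harmonic.
  by move=> m k mk; rewrite lef_pV2 ?posrE// ler_nat ltnS.
- apply: (@cvg_trans _ ((fun=> c - x) @ \oo)); last exact: cvg_cst.
  apply: near_eq_cvg; apply: nearW => k.
  by rewrite [x + _]addrC addrK scalerA mulVf ?scale1r// gt_eqF.
Qed.

Variables (xa xb : T -> \bar R).

Lemma box_convex (x c : LfunType mu p1) t : box p1 xa xb x -> box p1 xa xb c ->
  0 < t -> t <= 1 -> box p1 xa xb (x + t *: (c - x)).
Proof.
move=> Kx Kc t0 t1; apply: filterS2 Kx Kc => w /andP[ax xb'] /andP[ac cb].
rewrite LfunDE LfunZE LfunBE; have [xc|cx] := leP (x w) (c w).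
  rewrite (le_trans ax) ?lee_fin ?lerDl ?mulr_ge0 ?subr_ge0// ?(ltW t0)//=.
  apply: le_trans cb; rewrite lee_fin -lerBrDl ler_piMl// subr_ge0//.
apply/andP; split.
  apply: (le_trans ac); rewrite lee_fin -lerBlDl -(opprB (x w)) mulrN lerN2.
  by rewrite ler_piMl// subr_ge0 ltW.
apply: le_trans xb'; rewrite lee_fin gerDl pmulr_rle0// subr_le0 ltW//.
Qed.

(** The point equal to [c] where [y * (c - x) > 0] and to [x] elsewhere lies in
    the box, and testing [y] against it shows that this set is negligible. *)
Lemma box_localization (x : LfunType mu p1) y : box p1 xa xb x ->
  (forall c : LfunType mu p1, box p1 xa xb c -> pairing y (c - x) <= 0) ->
  forall c : LfunType mu p1, box p1 xa xb c -> {ae mu, forall w, y w * (c w - x w) <= 0}.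
Proof.
move=> Kx yK c Kc.
pose d0 w := if 0 < y w * (c w - x w) then c w - x w else 0.
have d0L : d0 \in Lfun mu p.
  apply: (@Lfun_dominated _ _ _ _ _ _ (c - x)) => //; last 2 first.
  - exact: LfunP.
  - apply: nearW => w; rewrite /d0 LfunBE; case: ifPn => // _.
    by rewrite normr0.
  apply: measurable_fun_ifT => //; last exact: measurable_funB.
  apply: measurable_fun_ltr => //; apply: measurable_funM => //.
  exact: measurable_funB.
pose dd : LfunType mu p1 := Lfun_Sub p1 d0L.
have ddE w : dd w = d0 w by [].
have Kd : box p1 xa xb (x + dd).
  apply: filterS2 Kx Kc => w; rewrite LfunDE ddE /d0.
  by case: ifPn => // _; rewrite ?addr0// addrC subrK.
have := yK _ Kd; rewrite addrC addKr => yd.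
have dd0 w : 0 <= y w * dd w.
  rewrite ddE /d0; case: ifPn; last by rewrite mulr0.
  exact: ltW.
apply: filterS (pairing_le0_ae p_gt1 pq dd0 yd) => w.
rewrite ddE /d0; case: ifPn => [_ ->//|].
by rewrite -leNgt.
Qed.

End normal_cones.

(** * Interior points of a box *)

(** The truncation at [e] makes the room finite on both sides even for infinite
    bounds; since [a < b], the room cannot vanish on both sides at once. *)
Lemma two_sided_room (R : realType) (a b : \bar R) (x e : R) :
    (a < b)%E -> (a <= x%:E <= b)%E -> 0 < e ->
  let dn := fine (mine (x%:E - a) e%:E)%E in
  let up := fine (mine (b - x%:E) e%:E)%E in
  [/\ 0 <= dn <= e, 0 <= up <= e, 0 < dn + up,
      (a <= (x - dn)%:E)%E & ((x + up)%:E <= b)%E].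
Proof.
move=> ab /andP[ax xb] e0.
have dnE : exists2 r : R, mine (x%:E - a)%E e%:E = r%:E &
    [/\ 0 <= r, r <= e, (a <= (x - r)%:E)%E & r = 0 -> a = x%:E].
  case: a ab ax => [a| |] ab ax.
  - exists (Num.min (x - a) e); first by rewrite -EFinB EFin_min.
    rewrite lee_fin in ax; rewrite lee_fin.
    have [h|h] := leP (x - a) e; split; [lra|lra|lra| |lra|lra|lra|].
    + by move=> h0; congr EFin; lra.
    + by move=> h0; move: e0; rewrite h0 ltxx.
  - by rewrite leye_eq in ax.
  - exists e; first by rewrite /= addey// /mine lt_leAnge leey.
    by split; rewrite ?leNye//; [lra|move=> h; move: e0; rewrite h ltxx].
have upE : exists2 r : R, mine (b - x%:E)%E e%:E = r%:E &
    [/\ 0 <= r, r <= e, ((x + r)%:E <= b)%E & r = 0 -> b = x%:E].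
  case: b ab xb => [b| |] ab xb.
  - exists (Num.min (b - x) e); first by rewrite -EFinB EFin_min.
    rewrite lee_fin in xb; rewrite lee_fin.
    have [h|h] := leP (b - x) e; split; [lra|lra|lra| |lra|lra|lra|].
    + by move=> h0; congr EFin; lra.
    + by move=> h0; move: e0; rewrite h0 ltxx.
  - exists e; first by rewrite /= addye// /mine lt_leAnge leey.
    by split; rewrite ?leey//; [lra|move=> h; move: e0; rewrite h ltxx].
  - by rewrite leeNy_eq in xb.
case: dnE => r -> [r0 re ar rx]; case: upE => t -> [t0 te tb tx] /=.
split => //; [by rewrite r0 re|by rewrite t0 te|].
rewrite lt_def addr_ge0// andbT paddr_eq0//; apply/negP => /andP[/eqP r00 /eqP t00].
by move: ab; rewrite rx// tx// ltxx.
Qed.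

Section strictly_positive_function.
Context d (T : measurableType d) (R : realType).
Variables (mu : {measure set T -> \bar R}) (sfmu : sigma_finite setT mu).
Variables (p : \bar R) (p1 : (1 <= p)%E).

(** On a cover by sets [F k] of finite measure, the weighted sum of indicators
    below is positive, at most one and of integral at most one, hence in every
    Lp. *)
Lemma Lfun_positive : exists e : LfunType mu p1, forall w, 0 < e w.
Proof.
have [F FT mF] := sfmu.
pose c k : R := (2 ^ k.+1)%:R^-1 / (1 + fine (mu (F k))).
have mF0 k : 0 < 1 + fine (mu (F k)) by rewrite ltr_pwDl// fine_ge0.
have c0 k : 0 < c k by rewrite divr_gt0// invr_gt0 ltr0n expn_gt0.
pose f k w : \bar R := ((c k)%:E * (\1_(F k) w)%:E)%E.
have f0 k w : (0 <= f k w)%E by rewrite mule_ge0// lee_fin// ltW.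
have mf k : measurable_fun setT (f k).
  apply: measurable_funeM; apply/measurable_EFinP.
  by apply: measurable_indic; case: (mF k).
pose psi w := (\sum_(k <oo) f k w)%E.
have mpsi : measurable_fun setT psi by apply: ge0_emeasurable_sum.
have psi0 w : (0 < psi w)%E.
  have [k _ Fkw] : (\bigcup_i F i) w by rewrite -FT.
  rewrite /psi (@nneseriesD1 _ _ k)//; apply: (@lt_le_trans _ _ (f k w)).
    by rewrite /f indicE mem_set// mule1 lte_fin.
  by rewrite leeDl// nneseries_ge0.
have psi1 w : (psi w <= 1%:E)%E.
  apply: le_trans (epsilon_trick0 xpredT ler01); apply: lee_nneseries => // k _.
  rewrite /f -EFinM lee_fin indicE div1r.
  apply: (@le_trans _ _ (c k)).
    by apply: ler_piMr; [exact: ltW|case: (_ \in _)].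
  by rewrite /c ler_pdivrMr// ler_peMr ?invr_ge0// lerDl fine_ge0.
have ipsi : (\int[mu]_w psi w <= 1%:E)%E.
  rewrite integral_nneseries//.
  apply: le_trans (epsilon_trick0 xpredT ler01).
  apply: lee_nneseries => [k _ _|k _]; first exact: integral_ge0.
  have [mFk Fkoo] := mF k.
  rewrite ge0_integralZl_EFin//; last 2 first.
    by apply/measurable_EFinP; exact: measurable_indic.
    by rewrite ltW.
  rewrite integral_indic// setIT.
  have Fkfin : mu (F k) \is a fin_num by rewrite ge0_fin_numE.
  rewrite -(fineK Fkfin) -EFinM lee_fin div1r /c mulrAC ler_pdivrMr//.
  by rewrite ler_wpM2l ?invr_ge0// lerDr.
have psifin w : psi w \is a fin_num.
  by rewrite ge0_fin_numE ?ltW//; apply: le_lt_trans (psi1 w) _; rewrite ltry.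
pose e w := fine (psi w).
have e0 w : 0 < e w.
  by rewrite /e fine_gt0// psi0/=; apply: le_lt_trans (psi1 w) _; rewrite ltry.
have e1 w : e w <= 1 by rewrite -lee_fin /e fineK.
have me : measurable_fun setT e by apply: measurableT_comp => //; exact: fine_measurable.
have eL : e \in Lfun mu p.
  apply/andP; rewrite !inE/=; split => //; rewrite /finite_norm.
  case: p p1 => [r r1|_|//].
  - rewrite unlock /Lnorm poweR_lty//.
    apply: (@le_lt_trans _ _ (\int[mu]_w psi w)%E); last first.
      by apply: le_lt_trans ipsi _; rewrite ltry.
    apply: ge0_le_integral => //.
    + by move=> w _; rewrite /= lee_fin powR_ge0.
    + exact: measurable_abse_poweR.
    + move=> w _ /=; rewrite -(fineK (psifin w)) lee_fin gtr0_norm//.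
      rewrite -[leRHS](powRr1 (ltW (e0 w))).
      by apply: ger_powR; rewrite ?e0 ?e1// -lee_fin.
  - rewrite unlock /Lnorm; case: ifPn => // _.
    apply: (@le_lt_trans _ _ 1%:E); last by rewrite ltry.
    apply/ess_supP; apply: nearW => w /=.
    by rewrite lee_fin gtr0_norm.
by exists (Lfun_Sub p1 eL).
Qed.

Variables (xa xb : T -> \bar R).
Hypothesis mxa : measurable_fun [set: T] xa.
Hypothesis mxb : measurable_fun [set: T] xb.
Hypothesis xab : {ae mu, forall w, (xa w < xb w)%E}.

(** The midpoint of the room left around [x] inside the box, once this room is
    truncated by a positive Lp function, is strict; a quarter of the room is a
    perturbation [s] that stays in the box in both directions. *)
Lemma box_interior (x : LfunType mu p1) : box p1 xa xb x ->
  exists x0 s : LfunType mu p1, [/\ {ae mu, forall w, 0 < s w},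
    {ae mu, forall w, (xa w < (x0 w)%:E < xb w)%E},
    box p1 xa xb (x0 + s) & box p1 xa xb (x0 - s)].
Proof.
move=> Kx; have [e e0] := Lfun_positive.
pose dn w := fine (mine ((x w)%:E - xa w) (e w)%:E)%E.
pose up w := fine (mine (xb w - (x w)%:E) (e w)%:E)%E.
have mx : measurable_fun setT (EFin \o x) by exact/measurable_EFinP.
have me : measurable_fun setT (EFin \o e) by exact/measurable_EFinP.
have mdn : measurable_fun setT dn.
  apply: measurableT_comp; first exact: fine_measurable.
  by apply: measurable_mine => //; exact: emeasurable_funB.
have mup : measurable_fun setT up.
  apply: measurableT_comp; first exact: fine_measurable.
  by apply: measurable_mine => //; exact: emeasurable_funB.
have bnd : {ae mu, forall w, [/\ 0 <= dn w <= e w, 0 <= up w <= e w,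
    0 < dn w + up w, (xa w <= (x w - dn w)%:E)%E & ((x w + up w)%:E <= xb w)%E]}.
  by apply: filterS2 xab Kx => w ab axb; exact: two_sided_room.
have md : measurable_fun setT (fun w => 2^-1 * (up w - dn w)).
  by apply: measurable_funM => //; exact: measurable_funB.
have ms : measurable_fun setT (fun w => 4^-1 * (up w + dn w)).
  by apply: measurable_funM => //; exact: measurable_funD.
have dL : (fun w => 2^-1 * (up w - dn w)) \in Lfun mu p.
  apply: (@Lfun_dominated _ _ _ _ _ _ e) => //; first exact: LfunP.
  apply: filterS bnd => w [/andP[d0 de] /andP[u0 ue] du _ _].
  rewrite (gtr0_norm (e0 w)) ler_norml; lra.
have sL : (fun w => 4^-1 * (up w + dn w)) \in Lfun mu p.
  apply: (@Lfun_dominated _ _ _ _ _ _ e) => //; first exact: LfunP.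
  apply: filterS bnd => w [/andP[d0 de] /andP[u0 ue] du _ _].
  rewrite (gtr0_norm (e0 w)) ler_norml; lra.
(* The step from [x] to the midpoint of the interval from [x - dn] to
   [x + up]. *)
pose dd : LfunType mu p1 := Lfun_Sub p1 dL.
pose s : LfunType mu p1 := Lfun_Sub p1 sL.
have ddE w : dd w = 2^-1 * (up w - dn w) by [].
have sE w : s w = 4^-1 * (up w + dn w) by [].
exists (x + dd), s; split.
- by apply: filterS bnd => w [_ _ du _ _]; rewrite sE; lra.
- apply: filterS bnd => w [/andP[d0 de] /andP[u0 ue] du ax xb'].
  rewrite LfunDE ddE (le_lt_trans ax) ?lte_fin//=; last by lra.
  by apply: (lt_le_trans _ xb'); rewrite lte_fin; lra.
- apply: filterS bnd => w [/andP[d0 de] /andP[u0 ue] du ax xb'].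
  rewrite 2!LfunDE ddE sE (le_trans ax) ?lee_fin//=; last by lra.
  by apply: (le_trans _ xb'); rewrite lee_fin; lra.
- apply: filterS bnd => w [/andP[d0 de] /andP[u0 ue] du ax xb'].
  rewrite LfunBE LfunDE ddE sE (le_trans ax) ?lee_fin//=; last by lra.
  by apply: (le_trans _ xb'); rewrite lee_fin; lra.
Qed.

End strictly_positive_function.

Section nondegenerate_pairing.
Context d (T : measurableType d) (R : realType).
Variables (mu : {measure set T -> \bar R}).
Variables (p q : \bar R) (p1 : (1 <= p)%E) (q1 : (1 <= q)%E).
Hypothesis p_gt1 : (1 < p)%E.
Hypothesis pq : (p^-1 + q^-1 = 1)%E.

(** Localisation in the box without bounds, tested on a positive function and
    its opposite. *)
Lemma pairing_eq0_ae (y : LfunType mu q1) : sigma_finite setT mu ->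
    (forall x : LfunType mu p1, pairing y x = 0) ->
  {ae mu, forall w, y w = 0}.
Proof.
move=> sfmu y0; have [e e0] := Lfun_positive sfmu p1.
have all_in (x : LfunType mu p1) : box p1 (cst -oo%E) (cst +oo%E) x.
  by apply: nearW => w; rewrite leNye leey.
have loc (c : LfunType mu p1) : {ae mu, forall w, y w * (c w - 0) <= 0}.
  apply: (box_localization p_gt1 pq (all_in 0)) => //.
  by move=> x _; rewrite y0.
apply: filterS2 (loc e) (loc (- e)) => w; rewrite LfunNE !subr0 mulrN oppr_le0.
by rewrite pmulr_lle0// pmulr_lge0// => ? ?; apply/eqP; rewrite eq_le; apply/andP.
Qed.

End nondegenerate_pairing.

(** * Multiples of an Lq function over a nonatomic measure *)

Section unbounded_multiple.
Context d (T : measurableType d) (R : realType).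
Variables (mu : {measure set T -> \bar R}).
Hypothesis mu_nonatomic : nonatomic mu.

(** Cut [A] in two parts of positive measure and keep the one with the smaller
    integral. *)
Lemma nonatomic_halving (f : T -> \bar R) (A : set T) :
    measurable_fun setT f -> (forall w, 0 <= f w)%E ->
    measurable A -> (0 < mu A)%E ->
  exists B, [/\ measurable B, B `<=` A, (0 < mu B)%E &
    forall M : R, (\int[mu]_(w in A) f w <= M%:E)%E ->
                  (\int[mu]_(w in B) f w <= (M / 2)%:E)%E].
Proof.
move=> mf f0 mA A0; have [B [mB BA /andP[B0 BltA]]] := mu_nonatomic mA A0.
have mD : measurable (A `\` B) by exact: measurableD.
have dBD : [disjoint B & A `\` B] by apply/disj_setPS => w [Bw [_ /(_ Bw)]].
have D0 : (0 < mu (A `\` B))%E.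
  rewrite lt0e measure_ge0 andbT; apply: contraTneq BltA => muD.
  have -> : mu A = (mu B + mu (A `\` B))%E.
    by rewrite -[in LHS](setDUK BA) measureU//; exact/eqP.
  by rewrite muD adde0 ltxx.
have split_A : (\int[mu]_(w in A) f w =
    \int[mu]_(w in B) f w + \int[mu]_(w in A `\` B) f w)%E.
  by rewrite -ge0_integral_setU// setDUK//; exact: measurable_funTS.
have half (b c : \bar R) (M : R) :
    (b <= c)%E -> (b + c <= M%:E)%E -> (b <= (M / 2)%:E)%E.
  move=> bc bcM; rewrite leNgt; apply/negP => Mb.
  have := lteD Mb (lt_le_trans Mb bc).
  by rewrite -EFinD -splitr ltNge bcM.
have [le|le] := leP (\int[mu]_(w in B) f w)%E (\int[mu]_(w in A `\` B) f w)%E.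
  by exists B; split => // M; rewrite split_A; exact: half.
exists (A `\` B); split => // M; rewrite split_A addeC.
by apply: half; exact: ltW.
Qed.

Lemma shrinking_sequence (f : T -> \bar R) (A0 : set T) :
    measurable_fun setT f -> (forall w, 0 <= f w)%E ->
    measurable A0 -> (0 < mu A0)%E ->
  exists A : (set T)^nat, [/\ forall k, measurable (A k), forall k, (0 < mu (A k))%E,
    forall k, A k `<=` A0, forall i k, (i <= k)%N -> A k `<=` A i &
    forall M : R, (\int[mu]_(w in A0) f w <= M%:E)%E ->
      forall k, (\int[mu]_(w in A k) f w <= (M / (2 ^ k)%:R)%:E)%E].
Proof.
move=> mf f0 mA0 A00.
pose S := {A : set T | measurable A /\ (0 < mu A)%E}.
have /choice[step stepP] : forall A : S, exists B : S, proj1_sig B `<=` proj1_sig A /\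
    forall M : R, (\int[mu]_(w in proj1_sig A) f w <= M%:E)%E ->
                  (\int[mu]_(w in proj1_sig B) f w <= (M / 2)%:E)%E.
  move=> [A [mA A_gt0]]; have [B [mB BA B0 BM]] := nonatomic_halving mf f0 mA A_gt0.
  by exists (exist _ B (conj mB B0)).
pose A k := iter k step (exist _ A0 (conj mA0 A00)).
have decr i k : (i <= k)%N -> proj1_sig (A k) `<=` proj1_sig (A i).
  move=> /subnK <-; elim: (k - i)%N => // n IH; rewrite addSn.
  by apply: subset_trans IH; exact: (stepP _).1.
exists (fun k => proj1_sig (A k)); split => //.
- by move=> k; case: (proj2_sig (A k)).
- by move=> k; case: (proj2_sig (A k)).
- by move=> k; exact: (decr 0%N).
- move=> M AM; elim=> [|k IH]; first by rewrite expn0 divr1.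
  have := (stepP _).2 _ IH.
  by rewrite -mulrA -invfM -natrM -expnSr.
Qed.

(** Along a decreasing sequence of nonnegligible sets [A k] over which the
    integral of [G ^ r] decays geometrically, take [z ^ r] to be [G ^ r] times
    the number of the sets [A k] that contain the point.  The geometric decay
    makes [z ^ r] integrable, while on [A N] the ratio [z ^ r / G ^ r] is at
    least [N + 1]. *)
Lemma exists_unbounded_multiple (r : R) (G : T -> R) (F : set T) :
    1 <= r -> G \in Lfun mu r%:E -> measurable F -> (0 < mu F)%E ->
    (forall w, F w -> 0 < G w) ->
  exists z : T -> R, [/\ z \in Lfun mu r%:E, forall w, 0 <= z w,
    forall w, ~ F w -> z w = 0 &
    forall C, ~ {ae mu, forall w, F w -> z w <= C * G w}].
Proof.
move=> r1 GL mF F0 G0; have r0 : 0 < r by apply: lt_le_trans r1.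
pose f w := (`|G w| `^ r)%:E.
have intf : mu.-integrable setT f := Lfun_integrable r1 GL.
have mf : measurable_fun setT f := measurable_int mu intf.
have f0 w : (0 <= f w)%E by rewrite lee_fin powR_ge0.
have [A [mA A0 AF Adecr AM]] := shrinking_sequence mf f0 mF F0.
pose M : R := fine (\int[mu]_w f w).
have FM : (\int[mu]_(w in F) f w <= M%:E)%E.
  rewrite /M fineK; last exact: integrable_fin_num.
  exact: ge0_subset_integral.
have M0 : 0 <= M by rewrite fine_ge0// integral_ge0.
pose h w := (\sum_(k <oo) (f \_ (A k)) w)%E.
have fA0 k w : (0 <= (f \_ (A k)) w)%E by rewrite patchE; case: ifP.
have mfA k : measurable_fun setT (f \_ (A k)).
  by apply/(measurable_restrict _ (mA k) measurableT) => //; exact: measurable_funTS.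
have mh : measurable_fun setT h by apply: ge0_emeasurable_sum.
have h0 w : (0 <= h w)%E by apply: nneseries_ge0.
have inth : (\int[mu]_w h w < +oo)%E.
  rewrite integral_nneseries//.
  apply: (@le_lt_trans _ _ (\sum_(k <oo) (2 * M / (2 ^ k.+1)%:R)%:E)%E).
    apply: lee_nneseries => [k _ _|k _]; first exact: integral_ge0.
    rewrite -integral_mkcond (le_trans (AM _ FM k))// lee_fin expnS natrM.
    by rewrite -mulf_div divff// mul1r.
  by apply: le_lt_trans (epsilon_trick0 xpredT _) _; rewrite ?mulr_ge0// ltry.
have ih : mu.-integrable setT h.
  apply/integrableP; split => //.
  by under eq_integral do rewrite gee0_abs//.
have hA N w : A N w -> (N.+1%:R%:E * f w <= h w)%E.
  move=> ANw; apply: le_trans (nneseries_lim_ge N.+1 (fun k _ _ => fA0 k w)).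
  rewrite (eq_big_nat _ _ (F2 := fun=> f w)).
    by rewrite /f sumEFin sumr_const_nat subn0 -EFinM mulr_natl.
  move=> i /andP[_ iN]; rewrite patchE mem_set//.
  by apply: (Adecr i N).
pose z w := fine (h w) `^ r^-1.
have zr w : z w `^ r = fine (h w).
  by rewrite /z -powRrM mulVf ?gt_eqF// powRr1// fine_ge0.
have z0 w : 0 <= z w by exact: powR_ge0.
have mz : measurable_fun setT z.
  apply: (@measurableT_comp _ _ _ _ _ _ (@powR R ^~ r^-1)) => //.
  by apply: measurableT_comp => //; exact: fine_measurable.
exists z; split => //.
- apply/andP; rewrite !inE/=; split => //; rewrite /finite_norm unlock /Lnorm.
  rewrite poweR_lty//; apply: le_lt_trans inth.
  apply: ge0_le_integral => //.
  + by move=> w _; rewrite /= lee_fin powR_ge0.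
  + exact: measurable_abse_poweR.
  + move=> w _; rewrite /= ger0_norm// zr.
    by case: (h w) (h0 w) => [?| |] //= ?; rewrite ?leey.
- move=> w Fw; rewrite /z (_ : h w = 0)%E ?powR0 ?invr_eq0 ?gt_eqF//.
  apply: eseries0 => k _ _; rewrite patchE memNset// => Ak.
  exact/Fw/AF/Ak.
move=> C zC; have [N CN] : exists N : nat, `|C| `^ r < N.+1%:R.
  exists (Num.truncn (`|C| `^ r)); exact: truncnS_gt.
have : {ae mu, forall w, ~ A N w}.
  apply: filterS2 zC (integrable_ae measurableT ih) => w zCw hfin ANw.
  have Fw := AF _ _ ANw; have Gw := G0 _ Fw.
  have fw : 0 < `|G w| `^ r by rewrite powR_gt0// normr_gt0 gt_eqF.
  have : N.+1%:R * `|G w| `^ r <= (`|C| * `|G w|) `^ r.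
    have := hA _ _ ANw; rewrite /f -EFinM -(fineK (hfin I)) lee_fin -zr.
    move=> /le_trans; apply; apply: ge0_ler_powR; rewrite ?nnegrE ?mulr_ge0 ?(ltW r0)//.
    by rewrite -normrM (le_trans (zCw Fw))// ler_norm.
  by rewrite powRM// ler_pM2r// leNgt CN.
case=> N0 [mN0 N00 AN0]; have : (mu (A N) <= mu N0)%E.
  apply: le_measure; rewrite ?inE//.
  by move=> w ANw; apply: AN0 => /= /(_ ANw).
by rewrite N00 leNgt A0.
Qed.

End unbounded_multiple.

(** * The sum of the two normal cones *)

Section nonclosedness.
Context d (T : measurableType d) (R : realType).
Variables (mu : {measure set T -> \bar R}).
Hypothesis sfmu : sigma_finite setT mu.
Hypothesis mu_nonatomic : nonatomic mu.
Variables (p : \bar R) (p1 : (1 <= p)%E).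
Hypothesis p_gt1 : (1 < p)%E.
Variables (q : R) (q1 : (1 <= q%:E)%E).
Hypothesis pq : (p^-1 + (q%:E)^-1 = 1)%E.
Variables (xa xb : T -> \bar R).
Hypothesis mxa : measurable_fun [set: T] xa.
Hypothesis mxb : measurable_fun [set: T] xb.
Hypothesis xab : {ae mu, forall w, (xa w < xb w)%E}.
(** [P] stands for the polyhedron, as a convex set on which membership is
    decided by the values of the pairings with finitely many functions. *)
Variables (r : nat) (f : 'I_r -> LfunType mu q1) (P : set (LfunType mu p1)).
Hypothesis P_convex : forall u u' (t : R), P u -> P u' -> 0 < t -> t <= 1 ->
  P (u + t *: (u' - u)).
Hypothesis P_saturated : forall x u, P u ->
  (forall i, pairing (f i) x = pairing (f i) u) -> P x.

Let K : set (LfunType mu p1) := box p1 xa xb.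
Let strict (x : LfunType mu p1) := {ae mu, forall w, (xa w < (x w)%:E < xb w)%E}.
Hypothesis no_strict : forall x, strict x -> ~ P x.

Lemma strict_convex x x' (t : R) : K x -> strict x' -> 0 < t -> t <= 1 ->
  strict (x + t *: (x' - x)).
Proof.
move=> Kx sx' t0 t1; apply: filterS2 Kx sx' => w /andP[ax xb'] /andP[ax' x'b].
have -> : (x + t *: (x' - x)) w = x w + t * (x' w - x w) by [].
have [xx'|x'x] := leP (x w) (x' w).
  apply/andP; split; last first.
    apply: le_lt_trans x'b; rewrite lee_fin -lerBrDl ler_piMl// subr_ge0//.
  have [xx'e|xx'n] := eqVneq (x w) (x' w).
    by rewrite -xx'e subrr mulr0 addr0 xx'e.
  apply: (le_lt_trans ax); rewrite lte_fin ltrDl mulr_gt0// subr_gt0.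
  by rewrite lt_neqAle xx'n.
apply/andP; split.
  apply: (lt_le_trans ax'); rewrite lee_fin -lerBlDl -(opprB (x w)) mulrN lerN2.
  by rewrite ler_piMl// subr_ge0 ltW.
by apply: lt_le_trans xb'; rewrite lte_fin gtrDl pmulr_rlt0// subr_lt0.
Qed.

Variable x : LfunType mu p1.
Hypotheses (Kx : K x) (Px : P x).

(** Separation is applied to the cone generated by the differences of strict
    points and points of [P].  It extends from strict points to the whole box
    because every segment from a point of the box to a strict point consists of
    strict points, its origin excepted. *)
Lemma separating_multiplier : exists l : 'I_r -> R,
  let y := \sum_i l i *: f i in
  [/\ forall c, K c -> 0 <= pairing y (c - x),
      forall u, P u -> pairing y (u - x) <= 0 &
      exists v : LfunType mu p1, pairing y v != 0].
Proof.
have [x0 [s [_ sx0 _ _]]] := box_interior sfmu mxa mxb xab Kx.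
pose E : set (LfunType mu p1) := [set e | exists (t : R) c u,
  [/\ 0 < t, strict c, P u & e = t *: (c - u)]].
have lf i : scalar (pairing (f i) : LfunType mu p1 -> R).
  exact: pairing_scalar.
have E0 : E !=set0 by exists (1 *: (x0 - x)), 1, x0, x.
have ED e e' : E e -> E e' -> E (e + e').
  move=> [t [c [u [t0 sc Pu ->]]]] [t' [c' [u' [t0' sc' Pu' ->]]]].
  have tt : 0 < t + t' by rewrite addr_gt0.
    (* The sum of [t *: (c - u)] and [t' *: (c' - u')] is [t + t'] times the
     difference of the barycentres. *)
pose s' := t' / (t + t').
  have s0 : 0 < s' by rewrite divr_gt0.
  have s1 : s' <= 1 by rewrite ler_pdivrMr// mul1r lerDr ltW.
  exists (t + t'), (c + s' *: (c' - c)), (u + s' *: (u' - u)); split => //.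
  - apply: strict_convex => //.
    by apply: filterS sc => w /andP[/ltW -> /ltW ->].
  - exact: P_convex.
  - by apply/LfuneqP => w; rewrite !(LfunDE, LfunNE, LfunZE) /s'; field; rewrite gt_eqF.
have EZ (t : R) e : 0 < t -> E e -> E (t *: e).
  move=> t0 [t' [c [u [t0' sc Pu ->]]]].
  by exists (t * t'), c, u; split; rewrite ?mulr_gt0// scalerA.
have Ef e : E e -> ~ forall i, pairing (f i) e = 0.
  move=> [t [c [u [t0 sc Pu ->]]]] fe; apply: (no_strict sc).
  apply: (P_saturated Pu) => i; apply/eqP; rewrite -subr_eq0.
  have /eqP := fe i; rewrite pairingZr// pairingBr// mulf_eq0.
  by rewrite gt_eqF.
have [l [l0 [v lv]]] := cone_separation lf E0 ED EZ Ef.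
exists l => y; have yE (c : LfunType mu p1) : pairing y c = \sum_i l i * pairing (f i) c.
  exact: pairing_suml.
have ycu c u : K c -> P u -> 0 <= pairing y (c - u).
  move=> Kc Pu; apply: (@affine_ge0 _ _ (pairing y (x0 - c))) => t t0 t1.
  rewrite -pairingZr// -pairingDr// yE; apply: l0.
  exists 1, (c + t *: (x0 - c)), u; split => //; first exact: strict_convex.
  by rewrite scale1r addrAC.
split.
- by move=> c Kc; exact: ycu.
- by move=> u Pu; rewrite -oppr_ge0 -mulN1r -pairingZr// scaleN1r opprB ycu.
- by exists v; rewrite yE.
Qed.

(** Directions annihilated by all [f i] are tangent to [P] both ways. *)
Lemma normal_cone_span y : normal_cone q1 P x y ->
  exists l : 'I_r -> R, {ae mu, forall w, y w = \sum_i l i * f i w}.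
Proof.
have starP c (t : R) : P c -> 0 < t -> t <= 1 -> P (x + t *: (c - x)).
  by move=> Pc; exact: P_convex.
move=> /(normal_cone_starP p_gt1 pq _ starP) Ny.
have ker (v : LfunType mu p1) : (forall i, pairing (f i) v = 0) -> pairing y v = 0.
  move=> fv; have Pv t : P (x + t *: v).
    by apply: (P_saturated Px) => i; rewrite pairingDr// pairingZr// fv mulr0 addr0.
  have := Ny _ (Pv 1); have := Ny _ (Pv (-1)).
  rewrite ![x + _]addrC !addrK !pairingZr//; lra.
have [l yl] := span_of_common_kernel (fun i => pairing_scalar p_gt1 pq (f i))
  (pairing_scalar p_gt1 pq y) ker.
exists l; have : {ae mu, forall w, (y - \sum_i l i *: f i) w = 0}.
  by apply: (pairing_eq0_ae p_gt1 pq) => // v; rewrite pairingBl// pairing_suml// yl subrr.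
apply: filterS => w; rewrite LfunBE => /eqP; rewrite subr_eq0 => /eqP ->.
by rewrite Lfun_sumE.
Qed.

(** The contradiction is between a limit [z] of sums of normals, chosen too
    large for any multiple of [G], and the bound that a decomposition of [z]
    would impose. *)
Lemma normal_cone_sum_not_closed :
  ~ closed [set u + v | u in normal_cone q1 K x & v in normal_cone q1 P x].
Proof.
have Kstar c (t : R) : K c -> 0 < t -> t <= 1 -> K (x + t *: (c - x)).
  by move=> Kc; exact: box_convex.
have starP c (t : R) : P c -> 0 < t -> t <= 1 -> P (x + t *: (c - x)).
  by move=> Pc; exact: P_convex.
have [x0 [s [s0 _ Kxp Kxm]]] := box_interior sfmu mxa mxb xab Kx.
have [l] := separating_multiplier; set y := \sum_i _.
move=> /= [yK yP [v0 yv0]] closedN.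
pose F := [set w | y w != 0].
have mF : measurable F.
  rewrite (_ : F = ~` (y @^-1` [set 0])); first exact: measurableC.
  by apply/seteqP; split => w /= /eqP.
have F0 : (0 < mu F)%E.
  rewrite lt0e measure_ge0 andbT; apply: contra_neq yv0 => muF.
  have y0 : {ae mu, forall w, y w = 0}.
    by exists F; split => // w /= /eqP.
  apply/eqP; rewrite eq_le; apply/andP; split.
    by apply: (ae_pairing_le0 p_gt1 pq); apply: filterS y0 => w ->; rewrite mul0r.
  rewrite -oppr_le0 -mulN1r -pairingZr//; apply: (ae_pairing_le0 p_gt1 pq).
  by apply: filterS y0 => w ->; rewrite mul0r.
(* The summand [`|y|] makes [G] positive on [F]. *)
pose G : LfunType mu q1 := Lfun_abs y + \sum_i Lfun_abs (f i).
have GE w : G w = `|y w| + \sum_i `|f i w| by rewrite /G LfunDE Lfun_sumE.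
have G_gt0 w : F w -> 0 < G w.
  by move=> Fw; rewrite GE ltr_pwDl ?normr_gt0// sumr_ge0.
have [zeta [zL z0 zF zunb]] := exists_unbounded_multiple mu_nonatomic q1 (LfunP G) mF F0 G_gt0.
pose zf w := if 0 < y w then zeta w else - zeta w.
have mzeta : measurable_fun setT zeta by move: (zL) => /andP[/[!inE]].
have zfL : zf \in Lfun mu q%:E.
  apply: (Lfun_dominated q1 _ zL).
    apply: measurable_fun_ifT => //; first exact: measurable_fun_ltr.
    exact: measurableT_comp.
  by apply: nearW => w; rewrite /zf; case: ifP => _; rewrite ?normrN.
have zf0 w : y w = 0 -> zeta w = 0.
  by move=> yw; apply: zF; rewrite /F /= yw eqxx.
pose z : LfunType mu q1 := Lfun_Sub q1 zfL.
have zE w : z w = zf w by [].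
(* The truncations of [z] below the multiples of [`|y|]. *)
pose uf j w := if zeta w <= j%:R * `|y w| then zf w else 0.
have ufL j : uf j \in Lfun mu q%:E.
  apply: (Lfun_dominated q1 _ zfL).
    apply: measurable_fun_ifT => //.
    - apply: measurable_fun_ler => //; apply: measurable_funM => //.
      exact: measurableT_comp.
    - by move: (zfL) => /andP[/[!inE]].
  by apply: nearW => w; rewrite /uf; case: ifP => _ //; rewrite normr0.
pose u j : LfunType mu q1 := Lfun_Sub q1 (ufL j).
have uE j w : u j w = uf j w by [].
have uz : u @ \oo --> z.
  apply: cvg_eventually_eq => [w j|w]; rewrite ?uE zE.
    by rewrite /uf; case: ifP => _; rewrite ?subr0// subrr normr0.
  have [yw|yw] := eqVneq (y w) 0.
    by apply: nearW => j; rewrite uE /uf yw zf0// normr0 mulr0 lexx.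
  have := nbhs_infty_ger (zeta w / `|y w|); apply: filterS => j.
  by rewrite ler_pdivrMr ?normr_gt0// uE /uf => ->.
have yKx c : K c -> {ae mu, forall w, 0 <= y w * (c w - x w)}.
  move=> Kc; have : {ae mu, forall w, (-1 *: y) w * (c w - x w) <= 0}.
    apply: (box_localization p_gt1 pq Kx) Kc => c' Kc'.
    by rewrite pairingZl// mulN1r oppr_le0 yK.
  by apply: filterS => w; rewrite LfunZE mulN1r mulNr oppr_le0.
have uN j : [set u + v | u in normal_cone q1 K x & v in normal_cone q1 P x] (u j).
  (* Where [y > 0] the difference [u j - j *: y] is at most zero, and where
     [y < 0] at least zero. *)
  exists (u j - j%:R *: y); last first.
    exists (j%:R *: y); last by rewrite subrK.
    apply/(normal_cone_starP p_gt1 pq _ starP) => c Pc.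
    by rewrite pairingZl// mulr_ge0_le0// yP.
  apply/(normal_cone_starP p_gt1 pq _ Kstar) => c Kc.
  apply: (ae_pairing_le0 p_gt1 pq); apply: filterS (yKx c Kc) => w.
  rewrite !LfunBE LfunZE uE /uf /zf.
  have [yw|yw|yw] := ltgtP (y w) 0.
  - rewrite nmulr_rge0// ltr0_norm// => cx.
    apply: mulr_ge0_le0 => //; case: ifP => [zj|_]; first by lra.
    by rewrite sub0r oppr_ge0 mulr_ge0_le0// ltW.
  - rewrite pmulr_rge0// gtr0_norm// => cx.
    apply: mulr_le0_ge0 => //; case: ifP => [zj|_]; first by lra.
    by rewrite sub0r oppr_le0 mulr_ge0// ltW.
  - by move=> _; rewrite zf0// yw oppr0 if_same mulr0 subrr mul0r.
have [a Na [b Nb abz]] := @closed_cvg _ _ _ _ u _ closedN (nearW _ uN) z uz.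
have [k bE] := normal_cone_span Nb.
move: Na => /(normal_cone_starP p_gt1 pq _ Kstar).
move=> /(box_localization p_gt1 pq Kx) aK.
apply: (zunb (\sum_i `|k i|)).
near=> w => Fw.
have sw : 0 < s w by near: w; exact: s0.
have ap : a w * ((x0 + s) w - x w) <= 0 by near: w; exact: aK.
have am : a w * ((x0 - s) w - x w) <= 0 by near: w; exact: aK.
have yp : 0 <= y w * ((x0 + s) w - x w) by near: w; exact: yKx.
have ym : 0 <= y w * ((x0 - s) w - x w) by near: w; exact: yKx.
have bw : b w = \sum_i k i * f i w by near: w; exact: bE.
have zabw : zf w = a w + b w by rewrite -zE -abz.
(* The two perturbations of [x0] keep [x0 - x] away from zero, so the sign of
   [y w] forces the opposite sign on [a w]. *)
have zb : zeta w <= `|b w|.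
  move: ap am yp ym zabw; rewrite LfunDE LfunBE /zf.
  have [yw|yw|yw] := ltgtP 0 (y w); last by move: Fw; rewrite /F /= yw eqxx.
  - rewrite !(pmulr_rge0 _ yw) => ap _ _ ym zab.
    have : a w <= 0 by rewrite -(pmulr_lle0 _ (_ : 0 < x0 w + s w - x w))//; lra.
    by have := ler_norm (b w); lra.
  - rewrite !(nmulr_rge0 _ yw) => _ am yp _ zab.
    have : 0 <= a w by rewrite -(nmulr_lle0 _ (_ : x0 w - s w - x w < 0))//; lra.
    by have := lerNnormlW (lexx `|b w|); lra.
apply: (le_trans zb); rewrite bw; apply: (le_trans (ler_norm_sum _ _ _)).
rewrite mulr_suml; apply: ler_sum => i _; rewrite normrM ler_wpM2l// GE.
by rewrite (bigD1 i)//= addrCA lerDl addr_ge0// sumr_ge0.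
Unshelve. all: by end_near. Qed.

End nonclosedness.

(** * Polyhedra *)

Section polyhedron_theory.
Context d (T : measurableType d) (R : realType).
Variables (mu : {measure set T -> \bar R}).
Variables (p q : \bar R) (p1 : (1 <= p)%E) (q1 : (1 <= q)%E).
Hypothesis p_gt1 : (1 < p)%E.
Hypothesis pq : (p^-1 + q^-1 = 1)%E.
Variables (n m : nat) (g : 'I_n -> LfunType mu q1) (a : 'I_n -> R)
  (h : 'I_m -> LfunType mu q1) (b : 'I_m -> R).

Lemma polyhedron_convex (u v : LfunType mu p1) (t : R) :
  polyhedron p1 g a h b u -> polyhedron p1 g a h b v -> 0 < t -> t <= 1 ->
  polyhedron p1 g a h b (u + t *: (v - u)).
Proof.
move=> [ug uh] [vg vh] t0 t1; split => i; rewrite pairingDr// pairingZr// pairingBr//.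
  have t1' : 0 <= 1 - t by lra.
  have := ler_wpM2l t1' (ug i); have := ler_wpM2l (ltW t0) (vg i); lra.
by rewrite uh vh subrr mulr0 addr0.
Qed.

Definition constraint (i : 'I_(n + m)) : LfunType mu q1 :=
  match fintype.split i with inl j => g j | inr k => h k end.

Lemma polyhedron_saturated (x u : LfunType mu p1) :
  polyhedron p1 g a h b u ->
  (forall i, pairing (constraint i) x = pairing (constraint i) u) ->
  polyhedron p1 g a h b x.
Proof.
move=> [ug uh] xu; split => [j|k].
  by have := xu (unsplit (inl j)); rewrite /constraint unsplitK => ->.
by have := xu (unsplit (inr k)); rewrite /constraint unsplitK => ->.
Qed.

End polyhedron_theory.

Unset Implicit Arguments.

Theorem theorem4p5 (d : measure_display) (T : measurableType d) (R : realType)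
    (mu : {sigma_finite_measure set T -> \bar R})
    (p q : \bar R) (p1 : (1 <= p)%E) (q1 : (1 <= q)%E)
    (pq : (p^-1 + q^-1 = 1)%E)
    (xa xb : T -> \bar R)
    (mxa : measurable_fun [set: T] xa) (mxb : measurable_fun [set: T] xb)
    (n m : nat)
    (g : 'I_n -> LfunType mu q1) (a : 'I_n -> R)
    (h : 'I_m -> LfunType mu q1) (b : 'I_m -> R)
    (xab : {ae mu, forall w, (xa w < xb w)%E})
    (no_slater : ~ exists x : LfunType mu p1, slater_point xa xb g a h b x)
    (p_gt1 : (1 < p)%E)
    (mu_nonatomic : nonatomic mu) :
  forall x : LfunType mu p1,
    (box p1 xa xb `&` polyhedron p1 g a h b) x ->
    ~ closed [set u + v | u in normal_cone q1 (box p1 xa xb) x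
                        & v in normal_cone q1 (polyhedron p1 g a h b) x].
Proof.
move=> x [Kx Px]; move: q q1 pq g h no_slater Px => [r| |//] r1 pr g h noS Px.
- apply: (normal_cone_sum_not_closed (sigma_finiteT mu) mu_nonatomic p_gt1 pr
    mxa mxb xab _ _ _ Kx Px) => [u v t|y u|y sy [yg yh]].
  + exact: (polyhedron_convex p_gt1 pr).
  + exact: polyhedron_saturated.
  + by apply: noS; exists y.
- move: pr; rewrite invey adde0 => /eqP; rewrite inve_eq1 => /eqP pE; exfalso.
  by move: p_gt1; rewrite pE ltxx.
Qed.
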